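(* Let $k$ be a field (algebraically closed of characteristic $0$), $R=k[x_1,\dots,x_d]$, $\mathfrak m=(x_1,\dots,x_d)$, fix any term order on $R$, and let $I$ be an $\mathfrak m$-primary ideal of $R$ with initial ideal $\operatorname{in}(I)$. Then: (1) $\operatorname{HF}_I(n)\le\operatorname{HF}_{\operatorname{in}(I)}(n)$ for all $n\gg0$; (2) if $\operatorname{depth}\operatorname{gr}_{\operatorname{in}(I)}(R)>0$, then $\operatorname{HF}_I(n)\le\operatorname{HF}_{\operatorname{in}(I)}(n)$ for every $n\ge0$.
   Context: For an $\mathfrak m$-primary ideal $J$, $\operatorname{HF}_J(n)=\lambda(J^n/J^{n+1})$ (length as $R$-module), and $\operatorname{gr}_J(R)=\bigoplus_{n\ge0}J^n/J^{n+1}$. *)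

(* Defs.v *)
From HB Require Import structures.
From mathcomp Require Import all_boot all_order all_algebra.
From mathcomp Require Import mpoly.
From Stdlib Require Import ClassicalEpsilon.
Set Implicit Arguments. Unset Strict Implicit. Unset Printing Implicit Defensive.
Import Order.TTheory GRing.Theory.
Local Open Scope ring_scope.

Section Defs.
Variables (k : fieldType) (d : nat).
Local Notation R := {mpoly k[d]}.
Local Notation pset := (R -> Prop).

Definition is_ideal (J : pset) : Prop :=
  [/\ J 0, (forall f g, J f -> J g -> J (f + g)) & (forall r f, J f -> J (r * f))].

Definition subI (A B : pset) : Prop := forall f, A f -> B f.
Definition eqI (A B : pset) : Prop := subI A B /\ subI B A.

Definition ideal_gen (S : pset) : pset :=
  fun f => forall J, is_ideal J -> subI S J -> J f.

Definition ideal_mul (A B : pset) : pset :=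
  ideal_gen (fun f => exists a b, [/\ A a, B b & f = a * b]).

Fixpoint ideal_pow (J : pset) (n : nat) : pset :=
  match n with
  | 0 => fun _ => True
  | n'.+1 => ideal_mul (ideal_pow J n') J
  end.

Definition max_ideal : pset := ideal_gen (fun f => exists i : 'I_d, f = 'X_i).

Definition radical (J : pset) : pset := fun f => exists n, J (f ^+ n).

Definition is_primary (J : pset) : Prop :=
  is_ideal J /\ ~ J 1 /\
  forall a b, J (a * b) -> ~ J a -> exists n, J (b ^+ n).

Definition m_primary (J : pset) : Prop :=
  is_primary J /\ eqI (radical J) max_ideal.

(* length of the R-module J^n / J^{n+1}: submodules correspond to ideals L
   with J^{n+1} <= L <= J^n; a chain of length r is a strictly increasing
   chain J^{n+1} = L_0 < L_1 < ... < L_r = J^n; the length is the supremum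
   (maximum) of the lengths of such chains (0 if no maximum exists). *)
Definition sub_chain (A B : pset) (r : nat) : Prop :=
  exists L : nat -> pset,
    [/\ forall i, is_ideal (L i), eqI (L 0) A, eqI (L r) B &
        forall i, (i < r)%N -> subI (L i) (L i.+1) /\ ~ subI (L i.+1) (L i)].

Definition quot_length (A B : pset) : nat :=
  epsilon (inhabits 0%N)
    (fun l => sub_chain A B l /\ forall l', sub_chain A B l' -> (l' <= l)%N).

Definition HF (J : pset) (n : nat) : nat :=
  quot_length (ideal_pow J n.+1) (ideal_pow J n).

Definition term_order (le : rel 'X_{1..d}) : Prop :=
  [/\ reflexive le, antisymmetric le, transitive le & total le] /\
  (forall a b c, le a b -> le (a + c)%MM (b + c)%MM) /\
  (forall a, le 0%MM a).

Definition is_lead_mon (le : rel 'X_{1..d}) (f : R) (m : 'X_{1..d}) : Prop :=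
  m \in msupp f /\ forall m', m' \in msupp f -> le m' m.

Definition initial_ideal (le : rel 'X_{1..d}) (I : pset) : pset :=
  ideal_gen (fun g => exists f m, [/\ I f, f != 0, is_lead_mon le f m & g = 'X_[m]]).

(* the associated graded ring gr_J(R) = (+)_n J^n/J^{n+1}: an element is
   represented by a finite sequence s with s`_i in J^i (its component of
   degree i is the class of s`_i modulo J^{i+1}). *)
Definition gr_elt (J : pset) (s : seq R) : Prop := forall i, ideal_pow J i s`_i.
Definition gr_eq (J : pset) (s t : seq R) : Prop :=
  forall i, ideal_pow J i.+1 (s`_i - t`_i).
Definition gr_mul (s t : seq R) : seq R :=
  mkseq (fun n => \sum_(i < n.+1) s`_i * t`_(n - i)) (size s + size t).

(* maximal homogeneous ideal of gr_J(R): m/J (+) J/J^2 (+) ... *)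
Definition gr_maxhom (s : seq R) : Prop := max_ideal s`_0.

(* depth gr_J(R) > 0 : there is a gr_J(R)-regular sequence of length 1 in the
   maximal homogeneous ideal, i.e. an element x of it that is a nonzerodivisor
   on gr_J(R) with x gr_J(R) <> gr_J(R). *)
Definition depth_gr_pos (J : pset) : Prop :=
  exists x, [/\ gr_elt J x, gr_maxhom x,
    (forall y, gr_elt J y -> gr_eq J (gr_mul x y) [::] -> gr_eq J y [::]) &
    ~ (exists y, gr_elt J y /\ gr_eq J (gr_mul x y) [:: 1])].

End Defs.

(* Main.v *)
(* Write [codim V] for the number of monomials that are not leading monomials of
   elements of a cofinite subspace [V]; it is the dimension of [R / V], and lengths of
   quotients of ideals are differences of codimensions. Put [J = in(I)]. Since
   [J^n] is contained in [in(I^n)], the gap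
     [codim J^n - codim I^n = dim (in(I^n) / J^n)]
   is nonnegative, and its difference at [n] is [HF_J(n) - HF_I(n)].
   (1) Both Hilbert functions are eventually polynomial, hence so is the gap, and a
   nonnegative eventually polynomial function is eventually nondecreasing.
   (2) If [gr_J(R)] has positive depth, the sum [x] of the monomial generators of [J]
   is a nonzerodivisor of degree 1 on it, so multiplication by [x] embeds
   [in(I^n) / J^n] into [in(I^(n+1)) / J^(n+1)]: the gap is nondecreasing from the
   start. *)
Require Import Defs.
From HB Require Import structures.
From mathcomp Require Import all_boot all_order all_algebra.
From mathcomp Require Import zify ring.
From mathcomp Require Import mpoly.
From Stdlib Require Import ClassicalEpsilon.
Set Implicit Arguments. Unset Strict Implicit. Unset Printing Implicit Defensive.
Import Order.TTheory GRing.Theory.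
Local Open Scope ring_scope.

(** Excluded middle turns undecided predicates, such as being a leading monomial, into booleans that
    [count] and [filter] accept. *)
Definition holds (P : Prop) : bool :=
  if excluded_middle_informative P then true else false.

Lemma holdsP (P : Prop) : reflect P (holds P).
Proof. by rewrite /holds; case: excluded_middle_informative => h; constructor. Qed.

(** * Functions with eventually vanishing iterated differences *)

(** By Newton's formula, an eventually zero [r]-th difference means agreement for large [n] with a
    polynomial of degree less than [r]. Differences stay in [int], whereas the coefficients of that
    polynomial may be fractions. *)
Fixpoint eventually_poly (r : nat) (f : nat -> int) : Prop :=
  if r is r'.+1 then eventually_poly r' (fun n => f n.+1 - f n)
  else exists N, forall n, (N <= n)%N -> f n = 0.

Definition polynomial_like f := exists r, eventually_poly r f.

Lemma eventually_poly_ext r f g N :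
  (forall n, (N <= n)%N -> f n = g n) -> eventually_poly r f -> eventually_poly r g.
Proof.
elim: r f g => [|r IH] f g fg /=.
  case=> M fM; exists (maxn M N) => n; rewrite geq_max => /andP[Mn Nn].
  by rewrite -fg ?fM.
by apply: IH => n Nn; rewrite !fg // ltnW.
Qed.

Lemma eventually_polyS r f : eventually_poly r f -> eventually_poly r.+1 f.
Proof.
elim: r f => [|r IH] f; last exact: IH.
by case=> N fN; exists N => n Nn; rewrite !fN ?subr0 // ltnW.
Qed.

Lemma eventually_poly_le r s f :
  (r <= s)%N -> eventually_poly r f -> eventually_poly s f.
Proof.
move=> /subnK <-; elim: (s - r)%N => [//|i IH] /IH; exact: eventually_polyS.
Qed.

Lemma eventually_polyD r f g : eventually_poly r f -> eventually_poly r g ->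
  eventually_poly r (fun n => f n + g n).
Proof.
elim: r f g => [|r IH] f g /=.
  case=> N fN [M gM]; exists (maxn N M) => n; rewrite geq_max => /andP[Nn Mn].
  by rewrite fN ?gM ?addr0.
by move=> hf hg; apply: (@eventually_poly_ext _ _ _ 0) (IH _ _ hf hg) => n _ /=; ring.
Qed.

Lemma eventually_polyN r f : eventually_poly r f -> eventually_poly r (fun n => - f n).
Proof.
elim: r f => [|r IH] f /=.
  by case=> N fN; exists N => n Nn; rewrite fN // oppr0.
by move=> hf; apply: (@eventually_poly_ext _ _ _ 0) (IH _ hf) => n _ /=; ring.
Qed.

Lemma eventually_poly_shift r j f :
  eventually_poly r f -> eventually_poly r (fun n => f (n - j)%N).
Proof.
elim: r f => [|r IH] f /=.
  by case=> N fN; exists (N + j)%N => n Nn; rewrite fN //; lia.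
move=> hf; apply: (@eventually_poly_ext _ _ _ j) (IH _ hf) => n jn.
by rewrite subSn.
Qed.

Lemma polynomial_like0 : polynomial_like (fun=> 0).
Proof. by exists 0%N, 0%N. Qed.

Lemma polynomial_like_ext f g N :
  (forall n, (N <= n)%N -> f n = g n) -> polynomial_like f -> polynomial_like g.
Proof. by move=> fg [r hf]; exists r; apply: eventually_poly_ext fg hf. Qed.

Lemma polynomial_likeD f g : polynomial_like f -> polynomial_like g ->
  polynomial_like (fun n => f n + g n).
Proof.
case=> r hf [s hg]; exists (maxn r s); apply: eventually_polyD.
  exact: eventually_poly_le (leq_maxl _ _) hf.
exact: eventually_poly_le (leq_maxr _ _) hg.
Qed.

Lemma polynomial_likeN f : polynomial_like f -> polynomial_like (fun n => - f n).
Proof. by case=> r hf; exists r; apply: eventually_polyN. Qed.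

Lemma polynomial_like_shift j f :
  polynomial_like f -> polynomial_like (fun n => f (n - j)%N).
Proof. by case=> r hf; exists r; apply: eventually_poly_shift. Qed.

Lemma polynomial_like_antidiff f :
  polynomial_like (fun n => f n.+1 - f n) -> polynomial_like f.
Proof. by case=> r hf; exists r.+1. Qed.

Lemma polynomial_like_sum (J : finType) (F : J -> nat -> int) :
  (forall j, polynomial_like (F j)) -> polynomial_like (fun n => \sum_j F j n).
Proof.
move=> hF; elim: (index_enum J) => [|j s IH].
  by apply: (@polynomial_like_ext _ _ 0 _ polynomial_like0) => n _; rewrite big_nil.
apply: (@polynomial_like_ext _ _ 0 _ (polynomial_likeD (hF j) IH)) => n _.
by rewrite big_cons.
Qed.

(** Induction through the difference, whose sign is eventually constant: if it vanishes, [f] becomes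
    constant; if it is at least 1 or at most -1, [f] grows or falls at least linearly and ends up
    with that sign. *)
Lemma eventually_poly_sign r f : eventually_poly r f ->
  exists N, [\/ forall n, (N <= n)%N -> f n = 0,
                forall n, (N <= n)%N -> 1 <= f n
              | forall n, (N <= n)%N -> f n <= -1].
Proof.
elim: r f => [|r IH] f /=; first by case=> N fN; exists N; constructor 1.
case/IH => N [] hN.
- have fE i : f (N + i)%N = f N.
    by elim: i => [|i IHi]; rewrite ?addn0 // addnS -IHi; have := hN (N + i)%N; lia.
  have {}fE n : (N <= n)%N -> f n = f N by move=> /subnKC <-.
  exists N; case: (ltgtP (f N) 0) => h.
  + by constructor 3 => n /fE ->; lia.
  + by constructor 2 => n /fE ->; lia.
  + by constructor 1 => n /fE ->.
- have fE i : f N + i%:Z <= f (N + i)%N.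
    by elim: i => [|i IHi]; rewrite ?addn0 ?addr0 // addnS; have := hN (N + i)%N; lia.
  (* Beyond this point [n - N] exceeds the absolute value of [f N], so the linear bound is at least
     1. *)
  exists (N + `|f N| + 1)%N; constructor 2 => n Nn.
  have := fE (n - N)%N; rewrite subnKC; lia.
- have fE i : f (N + i)%N <= f N - i%:Z.
    by elim: i => [|i IHi]; rewrite ?addn0 ?subr0 // addnS; have := hN (N + i)%N; lia.
  exists (N + `|f N| + 1)%N; constructor 3 => n Nn.
  have := fE (n - N)%N; rewrite subnKC; lia.
Qed.

Lemma polynomial_like_ge0_nondecreasing f :
  polynomial_like f -> (forall n, 0 <= f n) ->
  exists N, forall n, (N <= n)%N -> f n <= f n.+1.
Proof.
(* Raising [r] by one unfolds to a statement about the difference of [f]; if that difference were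
   eventually negative, [f] would drop below 0. *)
case=> r /eventually_polyS /= /eventually_poly_sign [N [] hN] f0.
- by exists N => n /hN; lia.
- by exists N => n /hN; lia.
have fE i : f (N + i)%N <= f N - i%:Z.
  by elim: i => [|i IHi]; rewrite ?addn0 ?subr0 // addnS; have := hN (N + i)%N; lia.
by have := fE `|f N|.+1; have := f0 (N + `|f N|.+1)%N; have := f0 N; lia.
Qed.

(** * Hilbert functions of monomial sets in [N^s] *)

(** Exponent vectors of the monomials of degree [n] in [s] variables; running through the first
    entry in increasing order keeps the list lexicographically sorted. *)
Fixpoint compositions (s n : nat) : seq (seq nat) :=
  if s is s'.+1 then
    flatten [seq [seq j :: a | a <- compositions s' (n - j)] | j <- iota 0 n.+1]
  else if n == 0%N then [:: [::]] else [::].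

Lemma compositionsS s n : compositions s.+1 n =
  flatten [seq [seq j :: a | a <- compositions s (n - j)] | j <- iota 0 n.+1].
Proof. by []. Qed.

Lemma mem_compositions s n a :
  (a \in compositions s n) = (size a == s) && (sumn a == n).
Proof.
elim: s n a => [|s IH] n a; first by case: n a => [|n] [|j a].
rewrite compositionsS.
apply/flattenP/andP => [[_ /mapP[j + ->] /mapP[b + ->]]|].
  by rewrite mem_iota IH => ? /andP[/eqP sb /eqP nb]; rewrite /= sb nb; split; lia.
case: a => [|j a] [] //=; rewrite eqSS => sa /eqP na.
exists [seq j :: b | b <- compositions s (n - j)].
  by rewrite -[_ :: _]/(map _ (iota 0 n.+1)); apply/mapP; exists j => //;
    rewrite mem_iota; lia.
by apply: map_f; rewrite IH sa -na addKn eqxx.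
Qed.

Fixpoint lex_lt (a b : seq nat) : bool :=
  match a, b with
  | i :: a', j :: b' => (i < j)%N || (i == j) && lex_lt a' b'
  | _, _ => false
  end.

Lemma lex_lt_asym a b : lex_lt a b -> lex_lt b a = false.
Proof.
elim: a b => [|i a IH] [|j b] //= /orP[ij|/andP[/eqP -> /IH ->]].
  by rewrite ltnNge (ltnW ij) /= eq_sym (ltn_eqF ij).
by rewrite ltnn andbF.
Qed.

Lemma compositions_sorted s n : pairwise lex_lt (compositions s n).
Proof.
elim: s n => [|s IH] n; first by case: n.
rewrite compositionsS; elim: (iota 0 n.+1) (iota_ltn_sorted 0 n.+1) => [//|j l IHl] /= jl.
rewrite pairwise_cat; apply/and3P; split.
- apply/allrelP => _ _ /mapP[a _ ->] /flattenP[_ /mapP[i il ->] /mapP[c _ ->]] /=.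
  have /= := jl; rewrite (path_sortedE ltn_trans) => /andP[/allP/(_ _ il) -> _] //.
- rewrite pairwise_map; apply: sub_pairwise (IH (n - j)%N) => a b /= ->.
  by rewrite eqxx orbT.
- by apply: IHl; apply: path_sorted jl.
Qed.

Definition add_seq (a c : seq nat) := [seq (x.1 + x.2)%N | x <- zip a c].

Lemma size_add_seq a c : size a = size c -> size (add_seq a c) = size a.
Proof. by move=> sac; rewrite size_map size1_zip // sac. Qed.

Lemma sumn_add_seq a c :
  size a = size c -> sumn (add_seq a c) = (sumn a + sumn c)%N.
Proof.
elim: a c => [|i a IH] [|j c] //= [/IH]; rewrite /add_seq /= => ->; lia.
Qed.

Lemma lex_lt_add a b c : size a = size c -> size b = size c ->
  lex_lt a b -> lex_lt (add_seq a c) (add_seq b c).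
Proof.
elim: a b c => [|i a IH] [|j b] [|l c] //= [sa] [sb].
rewrite ltn_add2r eqn_add2r => /orP[-> //|/andP[-> h]].
by rewrite orbC -/(add_seq _ _) (IH b c).
Qed.

(** On vectors of length [s], such a [U] is the exponent set of a monomial ideal in [s]
    variables. *)
Definition up_closed (s : nat) (U : pred (seq nat)) :=
  forall a c, size a = s -> size c = s -> U a -> U (add_seq a c).

Definition slice (U : pred (seq nat)) (j : nat) : pred (seq nat) :=
  fun a => U (j :: a).

Lemma up_closed_slice s U j : up_closed s.+1 U -> up_closed s (slice U j).
Proof.
move=> up a c sa sc /(up _ (0%N :: c)); rewrite /add_seq /= addn0 sa sc.
exact.
Qed.

Lemma slice_mono s U i j a : up_closed s.+1 U -> (i <= j)%N -> size a = s ->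
  slice U i a -> slice U j a.
Proof.
move=> up ij sa /(up _ ((j - i)%N :: nseq s 0%N)).
rewrite /add_seq /= size_nseq sa subnKC // => /(_ erefl erefl).
suff -> : [seq (x.1 + x.2)%N | x <- zip a (nseq s 0%N)] = a by [].
by elim: a s sa {up} => [|l a IH] [|s] //= [/IH ->]; rewrite addn0.
Qed.

(* Dickson's lemma. *)
Lemma up_closed_chain_stable s (U : nat -> pred (seq nat)) :
  (forall n, up_closed s (U n)) ->
  (forall i j a, (i <= j)%N -> size a = s -> U i a -> U j a) ->
  exists N, forall n a, (N <= n)%N -> size a = s -> U n a = U N a.
Proof.
elim: s U => [|s IH] U up mono.
  case: (excluded_middle_informative (exists N, U N [::])) => [[N UN]|h].
    by exists N => n a Nn /size0nil ->; rewrite UN (mono N n).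
  exists 0%N => n a _ /size0nil ->.
  by apply/idP/idP => Un; case: h; [exists n | exists 0%N].
(* The diagonal slices increase with [n], so by induction they are stationary from some [N] on. *)
have [N hN] : exists N, forall n a, (N <= n)%N -> size a = s ->
    slice (U n) n a = slice (U N) N a.
  apply: (IH (fun n => slice (U n) n)) => [n|i j a ij sa Ui].
    exact: up_closed_slice.
  by apply: (slice_mono (up j) ij sa); apply: mono Ui => //=; rewrite sa.
(* Each single column is stationary too; a maximum then serves the finitely many columns below
   [N]. *)
have hcol i : exists M, forall n a, (M <= n)%N -> size a = s ->
    slice (U n) i a = slice (U M) i a.
  apply: (IH (fun n => slice (U n) i)) => [n|l j a lj sa]; first exact: up_closed_slice.
  by apply: mono => //=; rewrite sa.
have hcols l : exists M, forall i n a, (i < l)%N -> (M <= n)%N -> size a = s ->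
    slice (U n) i a = slice (U M) i a.
  elim: l => [|l [M hM]]; first by exists 0%N.
  have [M' hM'] := hcol l; exists (maxn M M') => i n a.
  rewrite ltnS geq_max leq_eqVlt => /orP[/eqP -> /andP[_ Mn] sa|il /andP[Mn _] sa].
    by rewrite hM' // [RHS]hM' // leq_maxr.
  by rewrite hM // [RHS]hM // leq_maxl.
have [M hM] := hcols N; exists (maxn N M) => n [//|i a] nn [sa].
have [Nn Mn] : (N <= n)%N /\ (M <= n)%N by move: nn; rewrite geq_max => /andP.
rewrite -!/(slice _ i a); case: (ltnP i N) => iN.
  by rewrite hM // [RHS]hM // leq_maxr.
(* A column of index at least [N] is squeezed between [slice (U N) N] and a later diagonal slice,
   which agree. *)
have stab j : (N <= j)%N -> slice (U j) i a = slice (U N) N a.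
  move=> Nj; apply/idP/idP => h; last first.
    by apply: (slice_mono (up j) iN sa); apply: mono h => //=; rewrite sa.
  rewrite -(hN (maxn i j)) ?leq_max ?iN //.
  apply: (slice_mono (up _) (leq_maxl i j) sa).
  by apply: mono h; rewrite ?leq_maxr //= sa.
by rewrite !stab // leq_maxl.
Qed.

Definition standard_count s (U : pred (seq nat)) n :=
  count (fun a => ~~ U a) (compositions s n).

Lemma standard_countS s U n :
  standard_count s.+1 U n = \sum_(j < n.+1) standard_count s (slice U j) (n - j).
Proof.
rewrite /standard_count compositionsS count_flatten -map_comp sumnE big_map.
rewrite (_ : \sum_(i < _) _ = \sum_(0 <= j < n.+1)
  standard_count s (slice U j) (n - j)); last by rewrite big_mkord.
by apply: eq_bigr => j _ /=; rewrite count_map.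
Qed.

Lemma eq_standard_count s U V n : (forall a, size a = s -> U a = V a) ->
  standard_count s U n = standard_count s V n.
Proof.
move=> UV; apply: eq_in_count => a; rewrite mem_compositions => /andP[/eqP sa _].
by rewrite UV.
Qed.

(** This is the Hilbert function of the quotient by a monomial ideal. By Dickson's lemma the slices
    are constant from [N] on, so the count is a finite sum of shifted slice counts plus a summatory
    function of the stable slice count. *)
Lemma standard_count_polynomial_like s U : up_closed s U ->
  polynomial_like (fun n => (standard_count s U n)%:Z).
Proof.
elim: s U => [|s IH] U up.
  (* Without variables the only exponent vector is empty, of degree 0, so the count vanishes from
     [n = 1] on. *)
  by exists 0%N, 1%N => n; rewrite /standard_count /=; case: n.
have [N hN] := @up_closed_chain_stable s (slice U)
   (fun j => @up_closed_slice s U j up)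
   (fun i j a ij sa => @slice_mono s U i j a up ij sa).
pose f j n := (standard_count s (slice U j) n)%:Z.
have pf j : polynomial_like (f j) by apply: IH; apply: up_closed_slice.
pose S n := \sum_(i < n.+1) f N i.
have pS : polynomial_like S.
  apply: polynomial_like_antidiff.
  apply: (@polynomial_like_ext (fun n => f N n.+1) _ 0).
    by move=> n _; rewrite /S [in RHS]big_ord_recr /=; ring.
  case: (pf N) => r hr; exists r.
  (* The forward shift is the function plus its difference, and both have order [r]. *)
  apply: (@eventually_poly_ext _ (fun n => f N n + (f N n.+1 - f N n)) _ 0).
    by move=> n _ /=; ring.
  by apply: eventually_polyD => //; apply: eventually_polyS hr.
apply: (@polynomial_like_ext
  (fun n => (\sum_(j < N) f j (n - j)%N) + S (n - N)%N) _ N); last first.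
  apply: polynomial_likeD; last exact: polynomial_like_shift.
  by apply: polynomial_like_sum => j; apply: polynomial_like_shift.
move=> n Nn; rewrite standard_countS -[n.+1](subnKC (leqW Nn)) big_split_ord /=.
rewrite PoszD !(big_morph _ PoszD (erefl 0%:Z)) subSn //; congr (_ + _).
rewrite /S (reindex_inj rev_ord_inj); apply: eq_bigr => i _ /=.
rewrite (@eq_standard_count s (slice U (N + i)) (slice U N)).
  by rewrite /f; congr (standard_count _ _ _)%:Z; have := ltn_ord i; lia.
by move=> a sa; rewrite hN // leq_addr.
Qed.

(** * Leading monomials and codimension *)

Lemma count_predU1 (T : eqType) (a b : pred T) (s : seq T) x :
  uniq s -> x \in s -> ~~ a x -> (forall y, b y = (y == x) || a y) ->
  count b s = (count a s).+1.
Proof.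
move=> us xs ax bE; rewrite (eq_count (a2 := predU (pred1 x) a)) //.
have := count_predUI (pred1 x) a s; rewrite (count_uniq_mem _ us) xs add1n => <-.
rewrite (eq_count (a1 := predI _ _) (a2 := pred0)) ?count_pred0 ?addn0 // => y /=.
by case: eqP => // ->; apply/negbTE.
Qed.

Lemma ltn_count (T : eqType) (a b : pred T) (s : seq T) x :
  uniq s -> subpred a b -> x \in s -> b x -> ~~ a x -> (count a s < count b s)%N.
Proof.
move=> us ab xs bx ax.
rewrite -(@count_predU1 _ a (fun y => (y == x) || a y) s x) //.
by apply: sub_count => y /orP[/eqP ->|/ab].
Qed.

Section Subspaces.
Variables (k : fieldType) (d : nat).
Local Notation R := {mpoly k[d]}.
Local Notation pset := (R -> Prop).
Implicit Types (A B J S V W : pset) (f h : R) (m : 'X_{1..d}).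

Definition is_subspace (V : pset) : Prop :=
  [/\ V 0, (forall f g, V f -> V g -> V (f + g)) & (forall c f, V f -> V (c *: f))].

Lemma ideal_subspace J : is_ideal J -> is_subspace J.
Proof. by case=> J0 JD JM; split=> // c f; rewrite -mul_mpolyC; apply: JM. Qed.

Lemma subspaceN V f : is_subspace V -> V f -> V (- f).
Proof. by case=> _ _ VZ Vf; rewrite -scaleN1r; apply: VZ. Qed.

Lemma subspaceB V f g : is_subspace V -> V f -> V g -> V (f - g).
Proof. by move=> sV Vf /(subspaceN sV); case: sV => _ VD _; apply: VD. Qed.

Lemma subspace_subr V f g : is_subspace V -> V (f - g) -> V g -> V f.
Proof. by move=> [_ VD _] Vfg Vg; rewrite -(subrK g f); apply: VD. Qed.

Lemma subspace_sum V (T : eqType) (s : seq T) (P : pred T) (F : T -> R) :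
  is_subspace V -> (forall i, i \in s -> P i -> V (F i)) ->
  V (\sum_(i <- s | P i) F i).
Proof.
case=> V0 VD _ hF; rewrite big_seq_cond; elim/big_ind: _ => // i /andP[]; exact: hF.
Qed.

Lemma subspace_monomials V f :
  is_subspace V -> (forall m, m \in msupp f -> V 'X_[m]) -> V f.
Proof.
move=> sV hf; rewrite [f]mpolyE; apply: subspace_sum => // m mf _.
by case: sV => _ _; apply; apply: hf.
Qed.

Lemma preim_mul_subspace V g : is_subspace V -> is_subspace (fun f => V (f * g)).
Proof.
case=> V0 VD VZ; split => [|f h|c f]; rewrite ?mul0r ?mulrDl -?scalerAl //.
- exact: VD.
- exact: VZ.
Qed.

Lemma preim_mul_ideal J g : is_ideal J -> is_ideal (fun f => J (f * g)).
Proof.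
case=> J0 JD JM; split => [|f h|c f]; rewrite ?mul0r ?mulrDl -?mulrA //.
- exact: JD.
- exact: JM.
Qed.

Definition adjoin (V : pset) (g : R) : pset := fun f => exists c, V (f - c *: g).

Lemma adjoin_subspace V g : is_subspace V -> is_subspace (adjoin V g).
Proof.
case=> V0 VD VZ; split.
- by exists 0; rewrite scale0r subr0.
- move=> f h [c Vf] [e Vh]; exists (c + e).
  by rewrite scalerDl opprD addrACA; apply: VD.
- by move=> c f [e Vf]; exists (c * e); rewrite -scalerA -scalerBr; apply: VZ.
Qed.

Lemma sub_adjoin V g : subI V (adjoin V g).
Proof. by move=> f Vf; exists 0; rewrite scale0r subr0. Qed.

Lemma adjoin_gen V g : is_subspace V -> adjoin V g g.
Proof. by case=> V0 _ _; exists 1; rewrite scale1r subrr. Qed.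

Lemma adjoin_sub V W g : is_subspace W -> subI V W -> W g -> subI (adjoin V g) W.
Proof.
move=> sW VW Wg f [c /VW Wf]; apply: subspace_subr Wf _ => //.
by case: sW => _ _; apply.
Qed.

(** The subspace [V + span(S)], as an intersection: an inclusion out of it is checked on [V] and on
    [S]. *)
Definition span_over (V S : pset) : pset :=
  fun f => forall W, is_subspace W -> subI V W -> subI S W -> W f.

Lemma span_over_subspace V S : is_subspace (span_over V S).
Proof.
split=> [W [W0 _ _] //|f g hf hg W sW VW SW|c f hf W sW VW SW].
- by case: (sW) => _ WD _; apply: WD; [apply: hf | apply: hg].
- by case: (sW) => _ _ WZ; apply: WZ; apply: hf.
Qed.

Lemma span_over_base V S : subI V (span_over V S).
Proof. by move=> f Vf W _ VW _; apply: VW. Qed.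

Lemma span_over_gen V S : subI S (span_over V S).
Proof. by move=> f Sf W _ _ SW; apply: SW. Qed.

Lemma span_over_min V S W :
  is_subspace W -> subI V W -> subI S W -> subI (span_over V S) W.
Proof. by move=> sW VW SW f; apply. Qed.

Lemma span_over_mono V V' S S' : subI V V' -> subI S S' ->
  subI (span_over V S) (span_over V' S').
Proof. by move=> VV SS f hf W sW VW SW; apply: hf => // g; [move/VV/VW | move/SS/SW]. Qed.

(** For an ideal this says that it contains the [N]-th power of the maximal ideal. It confines all
    counting to the finite list [monomials_below N]. *)
Definition cofinite (N : nat) (V : pset) := forall m, (N <= mdeg m)%N -> V 'X_[m].

Lemma cofinite_sub N V W : subI V W -> cofinite N V -> cofinite N W.
Proof. by move=> VW cV m /cV /VW. Qed.

Definition monomials_below (N : nat) : seq 'X_{1..d} :=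
  [seq bmnm b | b <- enum {: 'X_{1..d < N}}].

Lemma mem_monomials_below N m : (m \in monomials_below N) = (mdeg m < N)%N.
Proof.
apply/mapP/idP => [[b _ ->]|mN]; first exact: bmdeg.
by exists (BMultinom mN); rewrite ?mem_enum.
Qed.

Lemma monomials_below_uniq N : uniq (monomials_below N).
Proof. by rewrite map_inj_uniq ?enum_uniq //; apply: val_inj. Qed.

Definition truncation N (f : R) : R :=
  \sum_(m <- msupp f | (mdeg m < N)%N) f@_m *: 'X_[m].

Lemma mcoeff_truncation N f m :
  (truncation N f)@_m = if (mdeg m < N)%N then f@_m else 0.
Proof.
rewrite /truncation raddf_sum /=.
under eq_bigr do rewrite mcoeffZ mcoeffX.
case: (boolP (m \in msupp f)) => mf; last first.
  rewrite big_seq_cond big1 ?(memN_msupp_eq0 mf) ?if_same // => i /andP[if_ _].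
  by case: eqP => [im|_]; rewrite ?mulr0 //; move: mf; rewrite -im if_.
rewrite big_mkcond (bigD1_seq m) ?msupp_uniq //= eqxx mulr1 big1 ?addr0 //.
by move=> i /negbTE im; rewrite im mulr0 if_same.
Qed.

Lemma sub_truncation N V f : is_subspace V -> cofinite N V -> V (f - truncation N f).
Proof.
move=> sV cV; apply: subspace_monomials => // m.
rewrite mcoeff_msupp mcoeffB mcoeff_truncation; case: ltnP => [_|/cV //].
by rewrite subrr eqxx.
Qed.

(** * Leading monomials with respect to a term order *)

Variable (le : rel 'X_{1..d}).
Hypothesis Hle : term_order le.

Let lerr : reflexive le. Proof. by case: Hle => [[]]. Qed.
Let lean : antisymmetric le. Proof. by case: Hle => [[]]. Qed.
Let letr : transitive le. Proof. by case: Hle => [[]]. Qed.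
Let leto : total le. Proof. by case: Hle => [[]]. Qed.
Let leD a b c : le a b -> le (a + c)%MM (b + c)%MM.
Proof. by case: Hle => [_ [+ _]]; apply. Qed.

Lemma term_orderD_eq a b m n : le a m -> le b n -> (a + b = m + n)%MM ->
  a = m /\ b = n.
Proof.
move=> am bn ab; have h1 := leD b am.
have h2 : le (m + b)%MM (m + n)%MM by rewrite ![(m + _)%MM]addmC; apply: leD.
have mb : (a + b)%MM = (m + b)%MM by apply: lean; rewrite h1 ab.
split; first exact: addIm mb.
by apply: (@addmI _ m); rewrite -mb ab.
Qed.

Lemma seq_term_max (s : seq 'X_{1..d}) : s != [::] ->
  exists2 m, m \in s & forall m', m' \in s -> le m' m.
Proof.
elim: s => [//|a [|b s] IH] _.
  by exists a => [|m]; rewrite ?mem_head // inE => /eqP ->.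
have [//|m ms hm] := IH; case/orP: (leto a m) => am.
  exists m => [|m']; first by rewrite inE ms orbT.
  by rewrite inE => /predU1P[->|/hm].
exists a => [|m']; first exact: mem_head.
by rewrite inE => /predU1P[->|/hm /letr]; [|apply].
Qed.

Lemma lead_mon_exists f : f != 0 -> exists m, is_lead_mon le f m.
Proof. by rewrite -msupp_eq0 => /seq_term_max[m]; exists m. Qed.

(** By [term_orderD_eq], [m + n] can arise from the two supports only as this sum, so a single
    product of coefficients survives. *)
Lemma lead_mon_mcoeffM f g m n :
  (forall a, a \in msupp f -> le a m) -> (forall b, b \in msupp g -> le b n) ->
  (f * g)@_(m + n) = f@_m * g@_n.
Proof.
move=> hf hg; rewrite -{1}(subrK (f@_m *: 'X_[m]) f) mulrDl mcoeffD.
rewrite -scalerAl mcoeffZ ['X_[m] * g]mulrC mcoeffMX memN_msupp_eq0 ?add0r //.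
apply/negP => /msuppM_le/allpairsP[[a b] /= [af bg mnE]].
have afm : a \in msupp f /\ a != m.
  move: af; rewrite !mcoeff_msupp mcoeffB mcoeffZ mcoeffX.
  by have [<-|_] := eqVneq m a; rewrite ?mulr1 ?subrr ?eqxx // mulr0 subr0 => ->.
case: afm => {}af /eqP; apply.
by case: (term_orderD_eq (hf _ af) (hg _ bg) (esym mnE)).
Qed.

Lemma lead_monM f g m n :
  is_lead_mon le f m -> is_lead_mon le g n -> is_lead_mon le (f * g) (m + n)%MM.
Proof.
move=> [mf hf] [ng hg]; split.
  by rewrite mcoeff_msupp lead_mon_mcoeffM // mulf_neq0 // -mcoeff_msupp.
move=> _ /msuppM_le/allpairsP[[a b] /= [af bg ->]].
apply: letr (leD b (hf _ af)) _; rewrite ![(m + _)%MM]addmC; exact/leD/hg.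
Qed.

Lemma lead_monX m : is_lead_mon le ('X_[m] : R) m.
Proof. by split=> [|m']; rewrite msuppX inE // => /eqP ->. Qed.

(** Meant for arbitrary subspaces, since codimension is counted also for spans that are not known to
    be ideals. *)
Definition lead_set (V : pset) (m : 'X_{1..d}) : Prop :=
  exists2 f, V f & is_lead_mon le f m.

Lemma lead_set_mono V W m : subI V W -> lead_set V m -> lead_set W m.
Proof. by move=> VW [f Vf fm]; exists f => //; apply: VW. Qed.

Lemma cofinite_lead N V m : cofinite N V -> (N <= mdeg m)%N -> lead_set V m.
Proof. by move=> cV /cV Vm; exists 'X_[m] => //; apply: lead_monX. Qed.

(** Gaussian elimination: truncate an element of [W] modulo [V], then cancel its leading term by an
    element of [V] with the same leading monomial, and repeat. *)
Lemma sub_of_lead_set N V W : is_subspace V -> is_subspace W -> cofinite N V ->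
  subI V W -> (forall m, lead_set W m -> lead_set V m) -> subI W V.
Proof.
move=> sV sW cV VW hlead f.
(* Termination measure: the monomials of degree below [N] lying under a support monomial of degree
   below [N]. Each reduction removes the cancelled leading monomial from them; terms of degree at
   least [N] are not counted, as they lie in [V]. *)
pose below (f : R) m := has (fun m' => (mdeg m' < N)%N && le m m') (msupp f).
have [n] := ubnP (count (below f) (monomials_below N)).
elim: n f => [//|n IH] f; rewrite ltnS => hn Wf.
apply: (subspace_subr (g := truncation N f)) => //; first exact: sub_truncation.
set g := truncation N f.
have Wg : W g.
  rewrite -(subKr f g); apply: subspaceB => //; apply: VW; exact: sub_truncation.
have [->|/lead_mon_exists [m [mg hm]]] := eqVneq g 0; first by case: sV.
have [a Va [ma ha]] : lead_set V m by apply: hlead; exists g.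
pose c := g@_m / a@_m.
have ma0 : a@_m != 0 by rewrite -mcoeff_msupp.
have mN : (mdeg m < N)%N /\ m \in msupp f.
  move: mg; rewrite !mcoeff_msupp mcoeff_truncation.
  by case: ifP => //; rewrite eqxx.
apply: (subspace_subr (g := c *: a)) => //; last by case: sV => _ _; apply.
apply: IH; last by apply: subspaceB => //; case: sW => _ _; apply; apply: VW.
have lt_m m' : m' \in msupp (g - c *: a) -> le m' m /\ m' != m.
  move=> h; split.
    have := msuppB_le h; rewrite mem_cat => /orP[/hm //|/msuppZ_le/ha //].
  apply: contraTneq h => ->.
  by rewrite mcoeff_msupp mcoeffB mcoeffZ divfK // subrr eqxx.
apply: leq_trans hn; apply: (@ltn_count _ _ _ _ m).
- exact: monomials_below_uniq.
- move=> m1 /hasP[m' /lt_m [m'm _] /andP[_ m1m']]; apply/hasP; exists m.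
    by case: mN.
  by rewrite (letr m1m' m'm) andbT; case: mN.
- by rewrite mem_monomials_below; case: mN.
- by apply/hasP; exists m; rewrite ?lerr ?andbT; case: mN.
- apply/hasPn => m' /lt_m [m'm /eqP neq]; apply/negP => /andP[_ mm'].
  by apply: neq; apply: lean; rewrite m'm.
Qed.

Definition standard_monomials N (V : pset) : nat :=
  count (fun m => ~~ holds (lead_set V m)) (monomials_below N).

(** Choosing a bound by [epsilon] frees the notation from [N]; every valid bound gives the same
    count, because all monomials beyond a bound are leading monomials. *)
Definition codim (V : pset) : nat :=
  standard_monomials (epsilon (inhabits 0%N) (fun N => cofinite N V)) V.

Lemma codimE N V : cofinite N V -> codim V = standard_monomials N V.
Proof.
move=> cN; rewrite /codim; set M := epsilon _ _.
have cM : cofinite M V by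
  exact: (epsilon_spec _ (fun N => cofinite N V) (ex_intro _ N cN)).
rewrite /standard_monomials -!size_filter; apply/perm_size/uniq_perm.
- exact/filter_uniq/monomials_below_uniq.
- exact/filter_uniq/monomials_below_uniq.
move=> m; rewrite !mem_filter !mem_monomials_below.
case: holdsP => //= nl; apply/idP/idP => _.
  by case: ltnP => // /(cofinite_lead cN).
by case: ltnP => // /(cofinite_lead cM).
Qed.

(** Comparing leading monomials suffices, which allows spaces such as powers of [I] and of [in(I)],
    where neither need contain the other. *)
Lemma codim_lead_le N V W : cofinite N V -> cofinite N W ->
  (forall m, lead_set V m -> lead_set W m) -> (codim W <= codim V)%N.
Proof.
move=> cV cW VW; rewrite (codimE cV) (codimE cW).
by apply: sub_count => m; apply: contra => /holdsP/VW/holdsP.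
Qed.

Lemma codim_le N V W : cofinite N V -> subI V W -> (codim W <= codim V)%N.
Proof.
move=> cV VW; apply: codim_lead_le cV (cofinite_sub VW cV) _ => m.
exact: lead_set_mono.
Qed.

Lemma codim_eqI N V W : cofinite N V -> eqI V W -> codim V = codim W.
Proof.
move=> cV [VW WV]; apply/eqP; rewrite eqn_leq.
by rewrite (codim_le (cofinite_sub VW cV) WV) (codim_le cV VW).
Qed.

Lemma lead_set_new N V W : is_subspace V -> is_subspace W -> cofinite N V ->
  subI V W -> ~ subI W V -> exists2 m, lead_set W m & ~ lead_set V m.
Proof.
move=> sV sW cV VW nWV; apply: NNPP => h; apply: nWV.
apply: (sub_of_lead_set sV sW cV VW) => m Wm.
by apply: NNPP => nVm; apply: h; exists m.
Qed.

Lemma codim_lt N V W : is_subspace V -> is_subspace W -> cofinite N V ->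
  subI V W -> ~ subI W V -> (codim W < codim V)%N.
Proof.
move=> sV sW cV VW nWV; have [m Wm nVm] := lead_set_new sV sW cV VW nWV.
rewrite (codimE cV) (codimE (cofinite_sub VW cV)).
apply: (@ltn_count _ _ _ _ m); rewrite ?monomials_below_uniq //.
- by move=> m'; apply: contra => /holdsP/(lead_set_mono VW)/holdsP.
- by rewrite mem_monomials_below; case: ltnP => // /(cofinite_lead cV).
- by apply/holdsP.
- by rewrite negbK; apply/holdsP.
Qed.

(** Adjoining one vector creates at most one new leading monomial: given two different ones, a
    combination eliminating [g] lies in [V] and keeps the larger. *)
Lemma adjoin_lead_set V g m n : is_subspace V -> le n m ->
  lead_set (adjoin V g) m -> lead_set (adjoin V g) n ->
  ~ lead_set V m -> ~ lead_set V n -> m = n.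
Proof.
move=> sV nm [f [c Vf] [mf hf]] [h [e Vh] [nh hh]] nVm nVn.
apply/eqP; apply/negPn/negP => mn; apply: nVm.
have e0 : e != 0.
  apply/eqP => e0; apply: nVn; exists h => //.
  by move: Vh; rewrite e0 scale0r subr0.
have mh : h@_m = 0.
  apply/memN_msupp_eq0/negP => /hh mn'; move/eqP: mn; apply.
  by apply: lean; rewrite mn' nm.
exists (e *: f - c *: h).
  have -> : e *: f - c *: h = e *: (f - c *: g) - c *: (h - e *: g).
    by rewrite !scalerBr !scalerA mulrC opprB addrA subrK.
  by case: (sV) => _ _ VZ; apply: subspaceB => //; apply: VZ.
split=> [|m' /msuppB_le].
  by rewrite mcoeff_msupp mcoeffB !mcoeffZ mh mulr0 subr0 mulf_neq0 // -mcoeff_msupp.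
by rewrite mem_cat => /orP[/msuppZ_le/hf //|/msuppZ_le/hh/letr]; apply.
Qed.

Lemma codim_adjoin N V g : is_subspace V -> cofinite N V -> ~ V g ->
  codim V = (codim (adjoin V g)).+1.
Proof.
move=> sV cV nVg; have sW := adjoin_subspace g sV.
have VW := @sub_adjoin V g.
have [|m Wm nVm] := lead_set_new sV sW cV VW.
  by move=> h; apply: nVg; apply: h; apply: adjoin_gen.
rewrite (codimE cV) (codimE (cofinite_sub VW cV)).
apply: (@count_predU1 _ _ _ _ m); rewrite ?monomials_below_uniq //.
- by rewrite mem_monomials_below; case: ltnP => // /(cofinite_lead cV).
- by rewrite negbK; apply/holdsP.
move=> n; apply/idP/orP => [/holdsP nVn|[/eqP -> |]].
- case: (holdsP (lead_set (adjoin V g) n)) => Wn; [left | by right].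
  apply/eqP; case/orP: (leto n m) => h; last first.
    exact: (adjoin_lead_set sV h Wn Wm nVn nVm).
  exact/esym/(adjoin_lead_set sV h Wm Wn nVm nVn).
- exact/holdsP.
- by apply: contra => /holdsP/(lead_set_mono VW)/holdsP.
Qed.

(** * Powers of ideals, and lengths as differences of codimensions *)

Lemma ideal_gen_ideal S : is_ideal (ideal_gen S).
Proof.
split=> [J [] //|f g hf hg J iJ SJ|r f hf J iJ SJ].
- by case: (iJ) => _ JD _; apply: JD; [apply: hf | apply: hg].
- by case: (iJ) => _ _ JM; apply: JM; apply: hf.
Qed.

Lemma ideal_gen_sub S : subI S (ideal_gen S).
Proof. by move=> f Sf J _; apply. Qed.

Lemma ideal_gen_min S J : is_ideal J -> subI S J -> subI (ideal_gen S) J.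
Proof. by move=> iJ SJ f; apply. Qed.

Lemma ideal_pow_ideal J n : is_ideal (ideal_pow J n).
Proof. by case: n => [|n]; [split | apply: ideal_gen_ideal]. Qed.

Lemma ideal_pow_subspace J n : is_subspace (ideal_pow J n).
Proof. exact/ideal_subspace/ideal_pow_ideal. Qed.

Lemma ideal_mulP A B a b : A a -> B b -> ideal_mul A B (a * b).
Proof. by move=> Aa Bb; apply: ideal_gen_sub; exists a, b. Qed.

Lemma ideal_powS_sub J n : subI (ideal_pow J n.+1) (ideal_pow J n).
Proof.
apply: ideal_gen_min; first exact: ideal_pow_ideal.
move=> _ [a [b [Ja _ ->]]]; rewrite mulrC.
by case: (ideal_pow_ideal J n) => _ _; apply.
Qed.

Lemma ideal_pow_le J (m n : nat) : (m <= n)%N -> subI (ideal_pow J n) (ideal_pow J m).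
Proof.
move=> /subnK <-; elim: (n - m)%N => [|i IH] f //.
by rewrite addSn => /ideal_powS_sub/IH.
Qed.

Lemma ideal_pow1 J f : J f -> ideal_pow J 1 f.
Proof. by move=> Jf; rewrite -[f]mul1r; apply: ideal_mulP. Qed.

Lemma ideal_powM J (m n : nat) a b :
  ideal_pow J m a -> ideal_pow J n b -> ideal_pow J (m + n) (a * b).
Proof.
elim: n a b => [|n IH] a b Ja.
  by rewrite addn0 mulrC => _; case: (ideal_pow_ideal J m) => _ _; apply.
rewrite addnS mulrC; apply: (ideal_gen_min (preim_mul_ideal a _)).
  exact: ideal_pow_ideal.
move=> _ [b1 [b2 [Jb1 Jb2 ->]]]; rewrite mulrC mulrA.
by apply: ideal_mulP => //; apply: IH.
Qed.

Lemma mnm_pred m : m != 0%MM -> exists i n, m = (U_(i) + n)%MM.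
Proof.
move=> m0; have /existsP[i mi] : [exists i, m i != 0%N].
  apply: contraNT m0 => /existsPn h; apply/eqP/mnmP => i.
  by rewrite mnm0E; apply/eqP; have := h i; rewrite negbK.
exists i, (m - U_(i))%MM; rewrite addmC submK //.
apply/mnm_lepP => j; rewrite mnm1E; case: eqP => // <-.
by rewrite lt0n.
Qed.

Lemma mnm_split m e : (e <= mdeg m)%N ->
  exists a b, m = (a + b)%MM /\ mdeg a = e.
Proof.
elim: e => [|e IH] em; first by exists 0%MM, m; rewrite add0m mdeg0.
have [a [b [mE ae]]] := IH (ltnW em).
have /mnm_pred[i [n bE]] : b != 0%MM.
  by rewrite -mdeg_eq0 -lt0n -(ltn_add2l e) addn0 -{2}ae -mdegD -mE.
by exists (a + U_(i))%MM, n; rewrite mdegD mdeg1 ae addn1 mE bE addmA.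
Qed.

Lemma cofinite_pow N J n : cofinite N J -> cofinite (n * N) (ideal_pow J n).
Proof.
move=> cJ; elim: n => [//|n IH] m nm.
have [|a [b [mE ae]]] := @mnm_split m (n * N); first by apply: leq_trans nm; lia.
rewrite mE mpolyXD; apply: ideal_mulP; first by apply: IH; rewrite ae.
by apply: cJ; move: nm; rewrite mE mdegD ae; lia.
Qed.

(** Some power [e i] of each variable lies in [J], and a monomial of degree above the sum of the
    [e i] is divisible by one of these powers. *)
Lemma m_primary_cofinite J : m_primary J -> exists N, cofinite N J.
Proof.
case=> [[iJ _] [_ mJ]].
pose e i := epsilon (inhabits 0%N) (fun n => J ('X_i ^+ n)).
have Je i : J ('X_i ^+ e i).
  have [|n Jn] := mJ 'X_i; first by apply: ideal_gen_sub; exists i.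
  exact: (epsilon_spec _ (fun n => J ('X_i ^+ n)) (ex_intro _ n Jn)).
exists (\sum_i e i).+1 => m dm.
have /existsP[i ei] : [exists i, (e i <= m i)%N].
  apply: contraLR dm => /existsPn h; rewrite -leqNgt mdegE leq_sum // => i _.
  by have := h i; rewrite -ltnNge => /ltnW.
rewrite -(@submK _ (U_(i) *+ e i)%MM m).
  by rewrite mpolyXD -mpolyXn; case: iJ => _ _; apply.
apply/mnm_lepP => j; rewrite mulmnE mnm1E.
by case: eqP => [<-|_]; rewrite ?mul1n ?mul0n.
Qed.

(* The socle of [R / A] is essential: [A] contains a power of the maximal ideal. *)
Lemma socle_multiple N A f : is_ideal A -> cofinite N A -> ~ A f ->
  exists m, ~ A ('X_[m] * f) /\ forall i, A ('X_i * ('X_[m] * f)).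
Proof.
move=> iA cA nAf; case: (iA) => _ _ AM.
suff H n m : (N - mdeg m <= n)%N -> ~ A ('X_[m] * f) ->
    exists m, ~ A ('X_[m] * f) /\ forall i, A ('X_i * ('X_[m] * f)).
  by apply: (H N 0%MM); rewrite ?leq_subr // mpolyX0 mul1r.
elim: n m => [|n IH] m hm nAm.
  by case: nAm; rewrite mulrC; apply/AM/cA; rewrite -subn_eq0 -leqn0.
apply: NNPP => hno; case: (hno); exists m; split=> // i; apply: NNPP => nAi.
apply: hno; apply: (IH (U_(i) + m)%MM); first by rewrite mdegD mdeg1; lia.
by rewrite mpolyXD -mulrA.
Qed.

Lemma max_ideal_mul A g r : is_ideal A -> (forall i : 'I_d, A ('X_i * g)) ->
  max_ideal r -> A (r * g).
Proof.
move=> iA hg; apply: (ideal_gen_min (preim_mul_ideal g iA)).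
by move=> _ [i ->].
Qed.

Lemma adjoin_ideal A g : is_ideal A -> (forall i : 'I_d, A ('X_i * g)) ->
  is_ideal (adjoin A g).
Proof.
move=> iA hg; have sA := ideal_subspace iA.
have [? ? _] := adjoin_subspace g sA; split=> // r f [c Af].
case: (iA) => A0 AD AM.
(* Modulo [A], a polynomial acts on the socle element [g] through its constant term. Hence the line
   spanned by [g] is stable. *)
have h s : A (s * g - s@_0 *: g).
  rewrite -[s@_0]/(mcoeff 0%MM s).
  have sV : is_subspace (fun s => A (s * g - s@_0%MM *: g)).
    split=> [|s1 s2 h1 h2|b s1 h1].
    - by rewrite mul0r mcoeff0 scale0r subr0.
    - by rewrite mulrDl mcoeffD scalerDl opprD addrACA; apply: AD.
    - by rewrite mcoeffZ -scalerAl -scalerA -scalerBr; case: sA => _ _; apply.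
  apply: (subspace_monomials sV) => m _; rewrite mcoeffX.
  have [->|m0] := eqVneq m 0%MM; first by rewrite mpolyX0 mul1r scale1r subrr.
  rewrite scale0r subr0; have [i [n ->]] := mnm_pred m0.
  by rewrite mpolyXD ['X_i * _]mulrC -mulrA; apply: AM.
exists (c * r@_0%MM).
have -> : r * f - (c * r@_0%MM) *: g = r * (f - c *: g) + c *: (r * g - r@_0%MM *: g).
  by rewrite mulrBr scalerBr scalerA scalerAr addrA subrK.
by apply: AD; [apply: AM | case: sA => _ _; apply].
Qed.

(** While [A] is smaller than [B], some multiple of an element of [B] is a socle element modulo [A];
    adjoining it gives an ideal inside [B] of codimension one less. *)
Lemma ideal_chain_exists N A B : is_ideal A -> is_ideal B -> cofinite N A ->
  subI A B -> sub_chain A B (codim A - codim B).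
Proof.
move=> iA iB cA AB; move En : (codim A - codim B)%N => n.
elim: n A iA cA AB En => [|n IH] A iA cA AB En.
  exists (fun=> A); split=> //; first by split.
  split=> //; apply: NNPP => nBA.
  have := codim_lt (ideal_subspace iA) (ideal_subspace iB) cA AB nBA; lia.
have [f Bf nAf] : exists2 f, B f & ~ A f.
  apply: NNPP => h; have BA : subI B A.
    by move=> f Bf; apply: NNPP => nAf; apply: h; exists f.
  by have := codim_le (cofinite_sub AB cA) BA; lia.
have [m [nAg hg]] := socle_multiple iA cA nAf; set g := _ * f in nAg hg.
have iA' := adjoin_ideal iA hg.
have A'B : subI (adjoin A g) B.
  apply: adjoin_sub => //; first exact: ideal_subspace.
  by case: iB => _ _; apply.
have [|L [iL L0 Ln Ls]] := IH _ iA' (cofinite_sub (@sub_adjoin A g) cA) A'B.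
  by have := codim_adjoin (ideal_subspace iA) cA nAg; lia.
exists (fun i => if i is i'.+1 then L i' else A); split=> //.
- by case.
- by split.
case=> [_|i]; last exact: Ls.
split=> [f' Af'|h]; first by apply: L0.2; apply: sub_adjoin.
by apply: nAg; apply: h; apply: L0.2; apply: adjoin_gen; apply: ideal_subspace.
Qed.

Lemma ideal_chain_bound N A B r :
  cofinite N A -> sub_chain A B r -> (r <= codim A - codim B)%N.
Proof.
move=> cA [L [iL L0 Lr Ls]].
have cL i : (i <= r)%N -> cofinite N (L i).
  elim: i => [_|i IH ir]; first exact: cofinite_sub L0.2 cA.
  by apply: cofinite_sub (IH (ltnW ir)); case: (Ls i ir).
have h i : (i <= r)%N -> (i + codim (L i) <= codim (L 0%N))%N.
  elim: i => [//|i IH ir]; apply: leq_trans (IH (ltnW ir)).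
  rewrite addSnnS leq_add2l; have [s1 s2] := Ls i ir.
  exact: codim_lt (ideal_subspace (iL i)) (ideal_subspace (iL _)) (cL i (ltnW ir)) s1 s2.
have := h r (leqnn r).
rewrite (codim_eqI (cL 0%N (leq0n r)) L0) (codim_eqI (cL r (leqnn r)) Lr); lia.
Qed.

Lemma quot_lengthE N A B : is_ideal A -> is_ideal B -> cofinite N A ->
  subI A B -> quot_length A B = (codim A - codim B)%N.
Proof.
move=> iA iB cA AB; have hc := ideal_chain_exists iA iB cA AB.
have hb r := @ideal_chain_bound N A B r cA.
rewrite /quot_length; set l := epsilon _ _.
have [l1 l2] : sub_chain A B l /\ forall l', sub_chain A B l' -> (l' <= l)%N.
  exact: (epsilon_spec _ (fun l => sub_chain A B l /\
    forall l', sub_chain A B l' -> (l' <= l)%N) (ex_intro _ _ (conj hc hb))).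
by apply/eqP; rewrite eqn_leq hb //= l2.
Qed.

Lemma HF_codim N J n : cofinite N J ->
  (HF J n)%:Z = (codim (ideal_pow J n.+1))%:Z - (codim (ideal_pow J n))%:Z.
Proof.
move=> cJ; have cn := @cofinite_pow N J n.+1 cJ; have sub := @ideal_powS_sub J n.
rewrite /HF (quot_lengthE _ _ cn sub); try exact: ideal_pow_ideal.
by rewrite subzn // (codim_le cn).
Qed.

(** * Hilbert functions are eventually polynomial *)

(** Adjoining a missing element of [J] to the generators strictly lowers a finite codimension, so
    the process stops. *)
Lemma ideal_finitely_generated N J : is_ideal J -> cofinite N J ->
  exists fs : seq R,
    (forall f, f \in fs -> J f) /\ subI J (ideal_gen (fun f => f \in fs)).
Proof.
move=> iJ cJ; pose gen (fs : seq R) := ideal_gen (fun f => f \in fs).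
suff H n fs : (codim (gen fs) < n)%N -> cofinite N (gen fs) ->
    (forall f, f \in fs -> J f) ->
    exists fs : seq R, (forall f, f \in fs -> J f) /\ subI J (gen fs).
  (* Starting from all monomials of degree exactly [N] makes the first ideal cofinite. *)
  pose fs := [seq 'X_[m] : R | m <- monomials_below N.+1 & mdeg m == N].
  apply: (H _ fs (ltnSn _)) => [m Nm|f /mapP[m]].
    have [a [b [-> aN]]] := mnm_split Nm.
    rewrite mpolyXD mulrC; case: (ideal_gen_ideal (fun f => f \in fs)) => _ _; apply.
    apply: ideal_gen_sub; apply: map_f.
    by rewrite mem_filter aN eqxx mem_monomials_below aN /=.
  by rewrite mem_filter => /andP[/eqP mN _] ->; apply: cJ; rewrite mN.
elim: n fs => [//|n IH] fs hn cfs fsJ.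
have [h|h] := excluded_middle_informative (subI J (gen fs)); first by exists fs.
have [f Jf nf] : exists2 f, J f & ~ gen fs f.
  by apply: NNPP => h'; apply: h => f Jf; apply: NNPP => nf; apply: h'; exists f.
have sub : subI (gen fs) (gen (f :: fs)).
  apply: ideal_gen_min; first exact: ideal_gen_ideal.
  by move=> g gfs; apply: ideal_gen_sub; rewrite inE gfs orbT.
apply: (IH (f :: fs)); last 2 first.
- exact: cofinite_sub cfs.
- by move=> g; rewrite inE => /predU1P[->|/fsJ].
rewrite -ltnS; apply: leq_trans hn; rewrite ltnS.
apply: (codim_lt _ _ cfs sub); try exact/ideal_subspace/ideal_gen_ideal.
by move=> h'; apply: nf; apply: h'; apply: ideal_gen_sub; apply: mem_head.
Qed.

(** * Products of generators and their linear dependences *)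

Fixpoint power_product (fs : seq R) (a : seq nat) : R :=
  match fs, a with
  | f :: fs', j :: a' => f ^+ j * power_product fs' a'
  | _, _ => 1
  end.

Lemma power_product_nseq0 fs : power_product fs (nseq (size fs) 0%N) = 1.
Proof. by elim: fs => [//|f fs IH] /=; rewrite IH expr0 mulr1. Qed.

Lemma power_product_add fs a c : size a = size fs -> size c = size fs ->
  power_product fs (add_seq a c) = power_product fs a * power_product fs c.
Proof.
elim: fs a c => [|f fs IH] [|i a] [|j c] //=; first by rewrite mulr1.
by move=> [sa] [sc]; rewrite -/(add_seq a c) IH // exprD mulrACA.
Qed.

Lemma power_product_unit fs f : f \in fs -> exists c,
  [/\ size c = size fs, sumn c = 1%N & power_product fs c = f].
Proof.
elim: fs => [//|g fs IH]; rewrite inE => /predU1P[->|/IH[c [sc nc <-]]].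
  exists (1%N :: nseq (size fs) 0%N); split=> /=; rewrite ?size_nseq //.
  - by rewrite sumn_nseq mul0n addn0.
  - by rewrite power_product_nseq0 mulr1 expr1.
by exists (0%N :: c); rewrite /= sc nc expr0 mul1r.
Qed.

Definition power_products (fs : seq R) (u : R) (n : nat) : pset := fun f =>
  exists a, [/\ size a = size fs, sumn a = n & f = power_product fs a * u].

(** Along the sorted list, each vector either depends on [A] and the earlier ones, leaving the
    codimension unchanged, or lowers it by one. *)
Lemma codim_span_seq (T : eqType) (lt : rel T) N A (g : T -> R) (s : seq T) :
  (forall a b, lt a b -> lt b a = false) -> is_subspace A -> cofinite N A ->
  pairwise lt s ->
  codim A = (codim (span_over A (fun f => exists2 b, b \in s & f = g b)) +
    count (fun a => ~~ holds (span_over A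
      (fun f => exists b, [/\ b \in s, lt b a & f = g b]) (g a))) s)%N.
Proof.
move=> lt_asym sA cA.
elim/last_ind: s => [_|s a IH].
  rewrite addn0; apply: (codim_eqI cA); split; first exact: span_over_base.
  by move=> f; apply => // h [].
rewrite pairwise_rcons => /andP[/allP s_lt ss]; rewrite {}IH //.
set Vs := span_over A (fun f => exists2 b, b \in s & f = g b).
set Vsa := span_over A _.
have sVs : is_subspace Vs by apply: span_over_subspace.
have AVs : subI A Vs by apply: span_over_base.
have cVs : cofinite N Vs by apply: cofinite_sub cA.
have VsaE : eqI Vsa (adjoin Vs (g a)).
  split.
    move=> f; apply; first exact: adjoin_subspace.
      by move=> h /AVs; apply: sub_adjoin.
    move=> _ [b + ->]; rewrite mem_rcons inE => /predU1P[->|bs].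
      exact: adjoin_gen.
    by apply: sub_adjoin; apply: span_over_gen; exists b.
  apply: adjoin_sub; first exact: span_over_subspace.
    apply: span_over_mono => // f [b bs ->].
    by exists b; rewrite // mem_rcons inE bs orbT.
  by apply: span_over_gen; exists a; rewrite // mem_rcons mem_head.
have cVsa : cofinite N Vsa by apply: cofinite_sub cA; apply: span_over_base.
rewrite (codim_eqI cVsa VsaE) -cats1 count_cat /= addn0.
rewrite [in RHS](eq_in_count (a2 := fun c => ~~ holds (span_over A
      (fun f => exists b, [/\ b \in s, lt b c & f = g b]) (g c)))); last first.
  move=> c cs; congr (~~ _); apply/holdsP/holdsP; apply: span_over_mono => // f.
    case=> b [+ bc ->]; rewrite mem_cat inE => /orP[bs|/eqP ba]; first by exists b.
    by move: bc; rewrite ba (lt_asym _ _ (s_lt _ cs)).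
  by case=> b [bs bc ->]; exists b; rewrite mem_cat bs.
set hd := holds _; have -> : hd = holds (Vs (g a)).
  apply/holdsP/holdsP; apply: span_over_mono => // f.
    case=> b [+ ba ->]; rewrite mem_cat inE => /orP[bs|/eqP bE]; first by exists b.
    by move: ba; rewrite bE => aa; have := lt_asym _ _ aa; rewrite aa.
  by case=> b bs ->; exists b; rewrite mem_cat bs; split=> //; apply: s_lt.
case: holdsP => [Vsg|nVsg] /=.
  rewrite addn0; congr (_ + _)%N; apply: (codim_eqI cVs); split.
    exact: sub_adjoin.
  exact: adjoin_sub.
by rewrite (codim_adjoin sVs cVs nVsg) addn1 addSnnS.
Qed.

(** Abstracts the powers [J^(n+1)] with [fs] generating [J], so that spans of products can be
    absorbed into [W] one multiplier [u] at a time. *)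
Definition graded_family (fs : seq R) (W : nat -> pset) : Prop :=
  [/\ forall n, is_subspace (W n), forall n, exists N, cofinite N (W n) &
      forall n f g, f \in fs -> W n g -> W n.+1 (g * f)].

Lemma graded_family_power_product fs (W : nat -> pset) n g c : graded_family fs W ->
  size c = size fs -> W n g -> W (n + sumn c)%N (g * power_product fs c).
Proof.
case=> _ _ hW.
elim: fs hW c n g => [|f fs IH] hW [|j c] n g //=; rewrite ?mulr1 ?addn0 //.
case=> sc Wg; rewrite mulrA addnA; apply: IH => // [i h e ef|].
  by apply: hW; rewrite inE ef orbT.
elim: j => [|j IHj]; first by rewrite addn0 expr0 mulr1.
by rewrite addnS exprSr mulrA; apply: hW => //; rewrite mem_head.
Qed.

Lemma graded_family_span fs (W : nat -> pset) u : graded_family fs W ->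
  graded_family fs (fun n => span_over (W n) (power_products fs u n)).
Proof.
case=> sW cW hW; split.
- by move=> n; apply: span_over_subspace.
- by move=> n; have [N cN] := cW n; exists N;
    apply: cofinite_sub cN; apply: span_over_base.
move=> n f g ffs; move: g; pose T := span_over (W n.+1) (power_products fs u n.+1).
have sT : is_subspace T by apply: span_over_subspace.
move=> g; apply: (span_over_min (preim_mul_subspace f sT)).
  by move=> h Wh; apply: span_over_base; apply: hW.
move=> _ [a [sa na ->]]; apply: span_over_gen.
have [c [sc nc fE]] := power_product_unit ffs.
exists (add_seq a c); split; first by rewrite size_add_seq // sc.
  by rewrite sumn_add_seq ?sa // na nc addn1.
by rewrite power_product_add // fE mulrAC.
Qed.

(* The exponents [a] for which [f ^ a * u] depends on the preceding products
   of the same degree are stable under addition of exponents; the others index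
   a basis of the quotient. *)
Lemma span_polynomial_like fs (W : nat -> pset) u : graded_family fs W ->
  polynomial_like (fun n => (codim (W n))%:Z -
    (codim (span_over (W n) (power_products fs u n)))%:Z).
Proof.
move=> gW; have [sW cW _] := gW; pose s := size fs.
pose before (a : seq nat) : pset := fun f => exists b,
  [/\ b \in compositions s (sumn a), lex_lt b a & f = power_product fs b * u].
pose U a := holds (span_over (W (sumn a)) (before a) (power_product fs a * u)).
(* A dependence multiplied by a power product is again one: the lexicographic order is compatible
   with addition, and [W] absorbs the multiplication. *)
have upU : up_closed s U.
  move=> a c sa sc /holdsP Ua; apply/holdsP.
  have sac : size a = size c by rewrite sa.
  rewrite power_product_add // mulrAC.
  set T := span_over _ _; have sT : is_subspace T by apply: span_over_subspace.
  move: Ua; apply: (span_over_min (preim_mul_subspace _ sT)).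
    move=> g Wg; apply: span_over_base; rewrite sumn_add_seq //.
    exact: graded_family_power_product.
  move=> _ [b [+ ba ->]]; rewrite mem_compositions => /andP[/eqP sb /eqP nb].
  have sbc : size b = size c by rewrite sb.
  apply: span_over_gen; exists (add_seq b c); split.
  - by rewrite mem_compositions size_add_seq // sb !sumn_add_seq // nb !eqxx.
  - exact: lex_lt_add.
  - by rewrite power_product_add // mulrAC.
apply: (polynomial_like_ext (N := 0)) (standard_count_polynomial_like upU) => n _.
have [N cN] := cW n.
rewrite (codim_span_seq (fun a => power_product fs a * u)
  (@lex_lt_asym) (sW n) cN (compositions_sorted s n)).
have cS S : cofinite N (span_over (W n) S).
  by apply: cofinite_sub cN; apply: span_over_base.
rewrite (@codim_eqI N _ (span_over (W n) (power_products fs u n))); last 2 first.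
- exact: cS.
- split; apply: span_over_mono => // f.
    case=> a; rewrite mem_compositions => /andP[/eqP sa /eqP na] ->.
    by exists a.
  by case=> a [sa na ->]; exists a; rewrite ?mem_compositions ?sa ?na ?eqxx.
rewrite PoszD addrAC subrr add0r; congr Posz; apply: eq_in_count => a.
rewrite mem_compositions => /andP[_ /eqP na].
congr (~~ _); rewrite /U na; apply/holdsP/holdsP; apply: span_over_mono => // f;
  by case=> b []; rewrite ?na; exists b; rewrite ?na.
Qed.

(** The codimension drop telescopes over [us]: after one [u] is absorbed the family is still graded,
    and the next multiplier is treated over it. *)
Lemma spans_polynomial_like fs (W : nat -> pset) (us : seq R) : graded_family fs W ->
  polynomial_like (fun n => (codim (W n))%:Z -
    (codim (span_over (W n) (fun f => exists2 u, u \in us & power_products fs u n f)))%:Z).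
Proof.
elim: us W => [|u us IH] W gW; have [sW cW _] := gW.
  apply: (polynomial_like_ext (N := 0)) polynomial_like0 => n _.
  have [N cN] := cW n; apply/esym/eqP; rewrite subr_eq0; apply/eqP; congr Posz.
  apply: (codim_eqI cN); split; first exact: span_over_base.
  by move=> f; apply => // g [].
have := polynomial_likeD (span_polynomial_like u gW) (IH _ (graded_family_span u gW)).
apply: (polynomial_like_ext (N := 0)) => n _; rewrite addrA subrK; congr (_ - Posz _).
have [N cN] := cW n; apply: (@codim_eqI N).
  by apply: (cofinite_sub (@span_over_base _ _)); apply: (cofinite_sub _ cN);
    apply: span_over_base.
split=> f; apply; try exact: span_over_subspace.
- by apply: span_over_mono => // g gu; exists u; rewrite ?mem_head.
- by move=> g [v vus gv]; apply: span_over_gen; exists v => //; rewrite inE vus orbT.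
- by move=> g Wg; apply: span_over_base; apply: span_over_base.
- move=> g [v]; rewrite inE => /predU1P[-> gu|vus gv].
    by apply: span_over_base; apply: span_over_gen.
  by apply: span_over_gen; exists v.
Qed.

(** Modulo [J] every polynomial is a combination of monomials of degree below [N]; these finitely
    many multipliers and the degree [n] products of generators span [J^n] modulo [J^(n+1)]. *)
Lemma ideal_pow_spanned N J fs n : is_ideal J -> cofinite N J ->
  (forall f, f \in fs -> J f) -> subI J (ideal_gen (fun f => f \in fs)) ->
  subI (ideal_pow J n) (span_over (ideal_pow J n.+1) (fun f => exists2 u,
    u \in [seq 'X_[m] : R | m <- monomials_below N] & power_products fs u n f)).
Proof.
move=> iJ cJ fsJ Jfs; set us := map _ _.
pose M n := span_over (ideal_pow J n.+1)
  (fun f => exists2 u, u \in us & power_products fs u n f).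
have sM i : is_subspace (M i) by apply: span_over_subspace.
rewrite -/(M n); elim: n => [f _|n IH].
  apply: (subspace_subr (g := truncation N f) (sM 0%N)).
    apply: span_over_base; apply: ideal_pow1.
    by apply: sub_truncation => //; apply: ideal_subspace.
  apply: (subspace_sum (sM 0%N)) => m _ mN; have [_ _ MZ] := sM 0%N; apply: MZ.
  apply: span_over_gen; exists 'X_[m].
    by apply: map_f; rewrite mem_monomials_below.
  exists (nseq (size fs) 0%N); rewrite size_nseq sumn_nseq mul0n.
  by rewrite power_product_nseq0 mul1r.
have hgen f a : f \in fs -> ideal_pow J n a -> M n.+1 (a * f).
  move=> ffs /IH; apply: (span_over_min (preim_mul_subspace f (sM n.+1))).
    by move=> g Jg; apply: span_over_base; apply: ideal_mulP => //; apply: fsJ.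
  move=> _ [u uus [c [sc nc ->]]].
  have [e [se ne fE]] := power_product_unit ffs.
  apply: span_over_gen; exists u => //; exists (add_seq c e).
  rewrite size_add_seq ?sc ?se // sumn_add_seq ?sc ?se // nc ne addn1.
  by rewrite power_product_add // fE mulrAC.
case: (sM n.+1) => M0 MD MZ; case: (ideal_pow_ideal J n) => _ _ JM.
have hJ a b : ideal_pow J n a -> J b -> M n.+1 (a * b).
  move=> Ja /Jfs Gb; move: b Gb a Ja.
  (* [M n.+1] is known only to be a subspace; quantifying over all [a] makes the condition on [b]
     define an ideal. The multiplier [1] is generalised below for the same reason. *)
  apply: (@ideal_gen_min _ (fun b => forall a, ideal_pow J n a -> M n.+1 (a * b))).
    split=> [a _|b c hb hc a Ja|r b hb a Ja]; rewrite ?mulr0 ?mulrDr //.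
      by apply: MD; [apply: hb | apply: hc].
    by rewrite mulrCA mulrA; apply: hb; apply: JM.
  by move=> f ffs a; apply: hgen.
move=> f hf; rewrite -[f]mul1r; move: f hf 1.
apply: (@ideal_gen_min _ (fun f => forall r, M n.+1 (r * f))).
  split=> [r|f g hf hg r|s f hf r]; rewrite ?mulr0 ?mulrDr //; first exact: MD.
  by rewrite mulrA.
by move=> _ [a [b [Ja Jb ->]]] r; rewrite mulrA; apply: hJ => //; apply: JM.
Qed.

(** For [W n = J^(n+1)] the span is exactly [J^n], so the codimension drop is the Hilbert
    function. *)
Lemma HF_polynomial_like N J : is_ideal J -> cofinite N J ->
  polynomial_like (fun n => (HF J n)%:Z).
Proof.
move=> iJ cJ; have [fs [fsJ Jfs]] := ideal_finitely_generated iJ cJ.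
have gW : graded_family fs (fun n => ideal_pow J n.+1).
  split=> [n|n|n f g ffs Jg]; first exact: ideal_pow_subspace.
    by exists (n.+1 * N)%N; apply: cofinite_pow.
  by apply: ideal_mulP => //; apply: fsJ.
have := spans_polynomial_like [seq 'X_[m] : R | m <- monomials_below N] gW.
apply: (polynomial_like_ext (N := 0)) => n _; rewrite (HF_codim n cJ).
congr (_ - Posz _); have cn := @cofinite_pow N J n.+1 cJ.
apply: (codim_eqI (cofinite_sub (@span_over_base _ _) cn)); split; last first.
  exact: ideal_pow_spanned.
move=> f; apply; first exact: ideal_pow_subspace.
  exact: ideal_powS_sub.
move=> _ [u _ [a [sa <- ->]]].
rewrite mulrC; case: (ideal_pow_ideal J (sumn a)) => _ _; apply.
have gJ : graded_family fs (ideal_pow J).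
  split=> [i|i|i g h gfs Jh]; first exact: ideal_pow_subspace.
    by exists (i * N)%N; apply: cofinite_pow.
  by apply: ideal_mulP => //; apply: fsJ.
by have := @graded_family_power_product _ _ 0%N 1 a gJ sa I; rewrite mul1r.
Qed.

(** * Initial ideals *)

Definition supported (P : 'X_{1..d} -> Prop) : pset :=
  fun f => forall m, m \in msupp f -> P m.

Definition stable_under_add (P : 'X_{1..d} -> Prop) : Prop :=
  forall a c, P a -> P (a + c)%MM.

Lemma supportedX P m : supported P 'X_[m] <-> P m.
Proof.
by split=> [|Pm m']; [apply | ]; rewrite msuppX inE // => /eqP ->.
Qed.

Lemma supported_ideal P : stable_under_add P -> is_ideal (supported P).
Proof.
move=> sP; split=> [m|f g Pf Pg m|r f Pf m]; first by rewrite msupp0.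
  by move=> /msuppD_le; rewrite mem_cat => /orP[/Pf|/Pg].
by move=> /msuppM_le/allpairsP[[a b] /= [_ /Pf Pb ->]]; rewrite addmC; apply: sP.
Qed.

Lemma supported_eqI P V : is_subspace V -> (forall m, P m -> V 'X_[m]) ->
  subI (supported P) V.
Proof. by move=> sV PV f Pf; apply: subspace_monomials => // m /Pf/PV. Qed.

Lemma lead_set_supported P m : lead_set (supported P) m <-> P m.
Proof.
split=> [[f Pf [mf _]]|Pm]; first exact: Pf.
by exists 'X_[m]; [apply/supportedX | apply: lead_monX].
Qed.

Lemma lead_set_stable J : is_ideal J -> stable_under_add (lead_set J).
Proof.
case=> _ _ JM a c [f Jf fa]; exists ('X_[c] * f); first exact: JM.
by rewrite addmC; apply: lead_monM => //; apply: lead_monX.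
Qed.

(** The leading monomials of an ideal are stable under multiplication by monomials, so their linear
    span is already the ideal they generate. *)
Lemma initial_idealE J : is_ideal J ->
  eqI (initial_ideal le J) (supported (lead_set J)).
Proof.
move=> iJ; have sJ := lead_set_stable iJ; split.
  apply: ideal_gen_min; first exact: supported_ideal.
  by move=> _ [f [m [Jf _ fm ->]]]; apply/supportedX; exists f.
apply: supported_eqI => [|m [f Jf fm]]; first exact/ideal_subspace/ideal_gen_ideal.
apply: ideal_gen_sub; exists f, m; split=> //.
by apply/eqP => f0; case: fm; rewrite f0 msupp0.
Qed.

Lemma initial_idealX J m : is_ideal J -> lead_set J m <-> initial_ideal le J 'X_[m].
Proof.
move=> iJ; have [h1 h2] := initial_idealE iJ.
by split=> [/supportedX/h2 //|/h1/supportedX].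
Qed.

(** For an ideal [J], the exponent set of the monomial ideal [in(J)^n]. *)
Fixpoint lead_sums J n (m : 'X_{1..d}) : Prop :=
  if n is n'.+1 then exists a b, [/\ lead_sums J n' a, lead_set J b & m = (a + b)%MM]
  else True.

Lemma lead_sums_stable J n : is_ideal J -> stable_under_add (lead_sums J n).
Proof.
move=> iJ; case: n => [//|n] m c [a [b [ha hb ->]]].
by exists a, (b + c)%MM; split=> //; [apply: lead_set_stable | rewrite addmA].
Qed.

Lemma initial_ideal_powE J n : is_ideal J ->
  eqI (ideal_pow (initial_ideal le J) n) (supported (lead_sums J n)).
Proof.
move=> iJ; have [h1 h2] := initial_idealE iJ.
elim: n => [|n [IH1 IH2]]; first by split.
split.
  apply: ideal_gen_min; first exact/supported_ideal/lead_sums_stable.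
  move=> _ [f [g [/IH1 hf /h1 hg ->]]] _
    /msuppM_le/allpairsP[[a b] /= [/hf ha /hg hb ->]].
  by exists a, b.
apply: supported_eqI => [|m [a [b [ha hb ->]]]]; first exact: ideal_pow_subspace.
rewrite mpolyXD; apply: ideal_mulP; first by apply: IH2; apply/supportedX.
by apply/initial_idealX.
Qed.

Lemma lead_sums_pow J n m : lead_sums J n m -> lead_set (ideal_pow J n) m.
Proof.
elim: n m => [|n IH] m /=; first by exists 'X_[m] => //; apply: lead_monX.
case=> a [b [/IH[f Jf fa] [g Jg gb] ->]].
by exists (f * g); [apply: ideal_mulP | apply: lead_monM].
Qed.

Lemma initial_ideal_cofinite N J : is_ideal J -> cofinite N J ->
  cofinite N (initial_ideal le J).
Proof. by move=> iJ cJ m /(cofinite_lead cJ) h; apply/initial_idealX. Qed.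

Lemma initial_ideal_pow_lead J n m : is_ideal J ->
  lead_set (ideal_pow (initial_ideal le J) n) m -> lead_set (ideal_pow J n) m.
Proof.
move=> iJ /(lead_set_mono (initial_ideal_powE n iJ).1)/lead_set_supported.
exact: lead_sums_pow.
Qed.

(** * Positive depth of the associated graded ring *)

(* If [f] is in [J ^ l] but not in [J ^ l.+1] and its initial form is killed by
   the positive part of [gr_J], then by [socle_multiple] some monomial multiple of it
   is killed by the whole maximal homogeneous ideal. *)
Lemma depth_gr_pos_colon N J l f : is_ideal J -> cofinite N J -> depth_gr_pos J ->
  ideal_pow J l f -> (forall g, J g -> ideal_pow J l.+2 (g * f)) ->
  ideal_pow J l.+1 f.
Proof.
move=> iJ cJ [x [xJ x0 xreg _]] Jf hf; apply: NNPP => nJf.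
have [m [nJh hX]] := socle_multiple (ideal_pow_ideal J l.+1)
  (@cofinite_pow N J l.+1 cJ) nJf.
set h := 'X_[m] * f in nJh hX.
have Jh : ideal_pow J l h by case: (ideal_pow_ideal J l) => _ _; apply.
(* Components of [x] of positive degree kill the class of [h]: one factor from [J] multiplies [f]
   into [J^(l+2)]. *)
have killed i g : ideal_pow J i.+1 g -> ideal_pow J (l + i.+1).+1 (g * h).
  rewrite addnS; apply: (ideal_gen_min (preim_mul_ideal h (ideal_pow_ideal J _))).
  move=> _ [a [b [Ja Jb ->]]].
  have -> : a * b * h = (a * 'X_[m]) * (b * f) by rewrite /h mulrACA mulrA.
  have -> : (l + i).+2 = (i + l.+2)%N by rewrite !addnS addnC.
  apply: ideal_powM; last exact: hf.
  by rewrite mulrC; case: (ideal_pow_ideal J i) => _ _; apply.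
(* The homogeneous element of degree [l] given by the class of [h], which is nonzero; it will
   contradict the regularity of [x]. *)
pose y : seq R := rcons (nseq l 0) h.
have yE i : y`_i = if i == l then h else 0.
  rewrite /y nth_rcons size_nseq nth_nseq; case: (ltngtP i l) => //.
have Jy : gr_elt J y.
  move=> i; rewrite yE; case: eqP => [-> //|_].
  by case: (ideal_pow_ideal J i).
suff /(xreg y Jy) h0 : gr_eq J (gr_mul x y) [::].
  by apply: nJh; have := h0 l; rewrite yE eqxx nth_nil subr0.
move=> n; rewrite nth_nil subr0.
have [J0 _ _] := ideal_pow_ideal J n.+1.
case: (ltnP n (size x + size y)) => hn; last first.
  by rewrite /gr_mul nth_default // size_mkseq.
rewrite /gr_mul nth_mkseq //.
apply: subspace_sum => [|i _ _]; first exact: ideal_pow_subspace.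
rewrite yE; case: eqP => [il|_]; last by rewrite mulr0.
have nE : (l + i)%N = n by rewrite -il subnK // -ltnS.
suff : ideal_pow J (l + i).+1 (x`_i * h) by rewrite nE.
(* The degree 0 component of [x] lies in the maximal ideal and kills [h] by the socle property. *)
case: (val i) (xJ i) => [_|j Jx]; last exact: killed.
by rewrite addn0; apply: max_ideal_mul => //; apply: ideal_pow_ideal.
Qed.

Definition monomial_set V : Prop := forall f m, V f -> m \in msupp f -> V 'X_[m].

Lemma mcoeff_sumX (G : seq 'X_{1..d}) m :
  uniq G -> (\sum_(g <- G) 'X_[g] : R)@_m = (m \in G)%:R.
Proof.
move=> uG; rewrite raddf_sum /=; under eq_bigr do rewrite mcoeffX.
case: (boolP (m \in G)) => mG.
  by rewrite (bigD1_seq m) //= eqxx big1 ?addr0 // => i /negbTE ->.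
rewrite big_seq big1 // => i iG; case: eqP => // im.
by rewrite -im iG in mG.
Qed.

(* McCoy's argument: if [x * w] vanishes in [gr_J], where [x] is the sum of the
   monomials in [G], then for the largest monomial [g] of [G] the product of [g]
   with the leading term of [w] vanishes, and [g * w] reduces to a shorter
   polynomial killed by [x]; by induction every [g] in [G] kills [w]. *)
Lemma sum_monomials_regular J (G : seq 'X_{1..d}) : is_ideal J ->
  (forall n, monomial_set (ideal_pow J n)) -> uniq G ->
  (forall g, g \in G -> J 'X_[g]) ->
  (forall l f, ideal_pow J l f ->
     (forall g, g \in G -> ideal_pow J l.+2 ('X_[g] * f)) -> ideal_pow J l.+1 f) ->
  forall l w, ideal_pow J l w ->
    ideal_pow J l.+2 ((\sum_(g <- G) 'X_[g]) * w) -> ideal_pow J l.+1 w.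
Proof.
move=> iJ mJ uG GJ colon l w; set x := \sum_(g <- G) _.
have [n] := ubnP (size (msupp w)); elim: n l w => [//|n IH] l w.
rewrite ltnS => hn Jw Jxw.
have sJ i := ideal_pow_subspace J i.
have [->|/lead_mon_exists[y [yw hy]]] := eqVneq w 0; first by case: (sJ l.+1).
have Jx : J x by apply: subspace_sum => [|g /GJ //]; exact: ideal_subspace.
have JS a f i : J a -> ideal_pow J i f -> ideal_pow J i.+1 (a * f).
  by move=> Ja Jf; rewrite mulrC; apply: ideal_mulP.
apply: colon => //.
(* Generalised to sublists so that the largest monomial can be removed once it is known to kill
   [w]. *)
suff H (G' : seq 'X_{1..d}) : uniq G' -> {subset G' <= G} ->
    ideal_pow J l.+2 ((\sum_(g <- G') 'X_[g]) * w) ->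
    forall g, g \in G' -> ideal_pow J l.+2 ('X_[g] * w) by exact: H.
have [r] := ubnP (size G'); elim: r G' => [//|r IHr] G'.
rewrite ltnS => hr uG' sG' JG'.
have [->//|/seq_term_max[g gG' hg]] := eqVneq G' [::].
(* The top monomial [g + y] of the product has coefficient [w@_y], hence occurs in it, and [J^(l+2)]
   is a monomial ideal. *)
have Jgy : ideal_pow J l.+2 'X_[g + y].
  apply: (mJ _ _ _ JG'); rewrite mcoeff_msupp lead_mon_mcoeffM //.
    by rewrite mcoeff_sumX // gG' mul1r -mcoeff_msupp.
  move=> a; rewrite mcoeff_msupp mcoeff_sumX //; case: (boolP (a \in G')) => [/hg //|].
  by rewrite eqxx.
pose w' := w - w@_y *: 'X_[y].
have wE : w = w' + w@_y *: 'X_[y] by rewrite subrK.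
(* Induction one level up, at [l.+1]: [w'] has lost the leading term, and [x] sends this product
   into [J^(l+3)]. *)
have Jgw' : ideal_pow J l.+2 ('X_[g] * w').
  apply: IH.
  - rewrite mulrC (perm_size (msuppMX _ _)) size_map (perm_size (msupp_rem _ _)).
    by rewrite size_rem // prednK //; case: (msupp w) yw.
  - apply: JS; first exact/GJ/sG'.
    apply: subspaceB => //; case: (sJ l) => _ _; apply; exact: (mJ _ _ _ Jw yw).
  have -> : x * ('X_[g] * w') = 'X_[g] * (x * w) - w@_y *: (x * 'X_[g + y]).
    rewrite /w' mpolyXD !mulrBr -!scalerAr; congr (_ - _ *: _).
      by rewrite mulrCA.
  apply: (subspaceB (sJ l.+3)); first by apply: JS => //; apply/GJ/sG'.
  by have [_ _ JZ] := sJ l.+3; apply: JZ; apply: JS.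
have Jgw : ideal_pow J l.+2 ('X_[g] * w).
  case: (sJ l.+2) => _ JD JZ.
  by rewrite wE mulrDr -scalerAr -mpolyXD; apply: JD => //; apply: JZ.
move=> g'; have [-> //|g'g] := eqVneq g' g; move=> g'G.
apply: (IHr (rem g G')).
- by rewrite size_rem // prednK //; case: (G') gG'.
- exact: rem_uniq.
- by move=> h /mem_rem/sG'.
- move: JG'; rewrite (perm_big _ (perm_to_rem gG')) big_cons mulrDl.
  set S := \sum_(_ <- _) _ => h.
  have -> : S * w = 'X_[g] * w + S * w - 'X_[g] * w by rewrite addrAC subrr add0r.
  exact: (subspaceB (sJ l.+2) h Jgw).
- by rewrite mem_rem_uniq // inE g'g.
Qed.

(** Multiplication by [x] induces an injection of [B / A] into [W / V]. To compare dimensions, [f]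
    is adjoined to [A] and [f * x] to [V] simultaneously until [A] fills [B]. *)
Lemma codim_mul_le M N A B V W x :
  is_subspace A -> is_subspace B -> is_subspace V -> is_subspace W ->
  cofinite M A -> cofinite N V -> subI A B -> subI V W ->
  (forall f, B f -> W (f * x)) -> (forall f, B f -> V (f * x) -> A f) ->
  (codim A + codim W <= codim V + codim B)%N.
Proof.
move=> + sB + sW; have [n] := ubnP (codim A); elim: n A V => [//|n IH] A V.
rewrite ltnS => hn sA sV cA cV AB VW BW inj.
have [BA|nBA] := excluded_middle_informative (subI B A).
  rewrite addnC leq_add ?(codim_le cV VW) //.
  exact: codim_le (cofinite_sub AB cA) BA.
have [f Bf nAf] : exists2 f, B f & ~ A f.
  by apply: NNPP => h; apply: nBA => f Bf; apply: NNPP => nAf; apply: h; exists f.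
have nVf : ~ V (f * x) by move/(inj f Bf).
have eA := codim_adjoin sA cA nAf; have eV := codim_adjoin sV cV nVf.
rewrite eA eV !addSn ltnS; apply: IH => //.
- by rewrite -eA.
- exact: adjoin_subspace.
- exact: adjoin_subspace.
- exact: cofinite_sub (@sub_adjoin A f) cA.
- exact: cofinite_sub (@sub_adjoin V _) cV.
- exact: adjoin_sub.
- by apply: adjoin_sub => //; apply: BW.
move=> h Bh [c Vh]; exists c; apply: inj; last by rewrite mulrBl -scalerAl.
by apply: subspaceB => //; case: sB => _ _; apply.
Qed.

(** * Comparison of an ideal with its initial ideal *)

Section Comparison.
Variables (I : pset) (N : nat).
Hypotheses (iI : is_ideal I) (cI : cofinite N I).
Local Notation J := (initial_ideal le I).

Let iJ : is_ideal J. Proof. exact: ideal_gen_ideal. Qed.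
Let cJ : cofinite N J. Proof. exact: initial_ideal_cofinite. Qed.

Definition codim_gap n : int :=
  (codim (ideal_pow J n))%:Z - (codim (ideal_pow I n))%:Z.

Lemma codim_gap_ge0 n : 0 <= codim_gap n.
Proof.
suff : (codim (ideal_pow I n) <= codim (ideal_pow J n))%N by rewrite /codim_gap; lia.
apply: (@codim_lead_le (n * N)).
- exact: cofinite_pow.
- exact: cofinite_pow.
- by move=> m; apply: initial_ideal_pow_lead.
Qed.

Lemma codim_gap_diff n : codim_gap n.+1 - codim_gap n = (HF J n)%:Z - (HF I n)%:Z.
Proof. rewrite (HF_codim n cJ) (HF_codim n cI) /codim_gap; lia. Qed.

Lemma HF_le_gap n : codim_gap n <= codim_gap n.+1 -> (HF I n <= HF J n)%N.
Proof. by have := codim_gap_diff n; lia. Qed.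

Lemma codim_gap_polynomial_like : polynomial_like codim_gap.
Proof.
apply: polynomial_like_antidiff.
apply: (polynomial_like_ext (N := 0)) (polynomial_likeD
  (HF_polynomial_like iJ cJ) (polynomial_likeN (HF_polynomial_like iI cI))) => n _.
by rewrite codim_gap_diff.
Qed.

Lemma initial_pow_monomial n : monomial_set (ideal_pow J n).
Proof.
have [h1 h2] := initial_ideal_powE n iI.
by move=> f m /h1 Pf /Pf Pm; apply: h2; apply/supportedX.
Qed.

(** A finite monomial generating set of [in(I)]: degrees up to and including [N] suffice, since all
    monomials of degree [N] lie in [I]. *)
Definition small_lead_monomials : seq 'X_{1..d} :=
  [seq m <- monomials_below N.+1 | holds (lead_set I m)].

Lemma small_lead_monomials_gen V : is_ideal V ->
  (forall g, g \in small_lead_monomials -> V 'X_[g]) -> subI J V.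
Proof.
move=> iV hV; case: (iV) => _ _ VM; apply: ideal_gen_min => // _ [f [m [If _ fm ->]]].
have Im : lead_set I m by exists f.
have mem m' : (mdeg m' <= N)%N -> lead_set I m' -> m' \in small_lead_monomials.
  by move=> ? ?; rewrite mem_filter mem_monomials_below ltnS andbC;
    apply/andP; split=> //; apply/holdsP.
case: (leqP (mdeg m) N) => mN; first exact/hV/mem.
have [a [b [-> aN]]] := mnm_split (ltnW mN).
rewrite addmC mpolyXD; apply/VM/hV/mem; first by rewrite aN.
by apply: (cofinite_lead cI); rewrite aN.
Qed.

(* Multiplication by the sum [x] of the monomial generators of [J] embeds
   [in(I^n) / J^n] into [in(I^(n+1)) / J^(n+1)]. *)
Lemma codim_gap_nondecreasing n : depth_gr_pos J -> codim_gap n <= codim_gap n.+1.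
Proof.
move=> dJ; pose G := small_lead_monomials; pose x : R := \sum_(g <- G) 'X_[g].
have GJ g : g \in G -> J 'X_[g].
  by rewrite mem_filter => /andP[/holdsP Ig _]; apply/initial_idealX.
have uG : uniq G by apply/filter_uniq/monomials_below_uniq.
have reg l w : ideal_pow J l w -> ideal_pow J l.+2 (x * w) -> ideal_pow J l.+1 w.
  apply: sum_monomials_regular => //; first exact: initial_pow_monomial.
  move=> i f Jf hf; apply: (depth_gr_pos_colon iJ cJ) => //.
  exact: (small_lead_monomials_gen (preim_mul_ideal f (ideal_pow_ideal J _))).
(* The monomial ideal [in(I^i)]. It contains [in(I)^i] and, having the same leading monomials as
   [I^i], has the same codimension. *)
pose F i := supported (lead_set (ideal_pow I i)).
have iF i : is_ideal (F i) by apply/supported_ideal/lead_set_stable/ideal_pow_ideal.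
have sub i : subI (ideal_pow J i) (F i).
  by move=> f /((initial_ideal_powE i iI).1) Pf m /Pf; apply: lead_sums_pow.
have cJn i : cofinite (i * N) (ideal_pow J i) by apply: cofinite_pow.
have FE i : codim (F i) = codim (ideal_pow I i).
  have cF : cofinite (i * N) (F i) by apply: cofinite_sub (cJn i).
  have cIn : cofinite (i * N) (ideal_pow I i) by apply: cofinite_pow.
  apply/eqP; rewrite eqn_leq (codim_lead_le cIn cF); last first.
    by move=> m /lead_set_supported.
  by rewrite (codim_lead_le cF cIn) // => m /lead_set_supported.
have := @codim_mul_le _ _ (ideal_pow J n) (F n) (ideal_pow J n.+1) (F n.+1) x
  (ideal_pow_subspace _ _) (ideal_subspace (iF n)) (ideal_pow_subspace _ _)
  (ideal_subspace (iF n.+1)) (cJn n) (cJn n.+1) (sub n) (sub n.+1).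
rewrite !FE /codim_gap => H; suff : (codim (ideal_pow J n) + codim (ideal_pow I n.+1) <=
  codim (ideal_pow J n.+1) + codim (ideal_pow I n))%N by lia.
apply: H => f Ff.
  move=> _ /msuppM_le/allpairsP[[a b] /= [/Ff[p Ip pa] bx ->]].
  have : b \in G.
    by move: bx; rewrite mcoeff_msupp mcoeff_sumX //; case: (b \in G); rewrite ?eqxx.
  rewrite mem_filter => /andP[/holdsP[q Iq qb] _].
  by exists (p * q); [apply: ideal_mulP | apply: lead_monM].
(* Injectivity: [f] climbs from [J^0] to [J^n], each step by regularity of [x], as [f * x] lies in
   [J^(n+1)] and so in [J^(i+2)] for [i < n]. *)
move=> Jfx; have : forall i, (i <= n)%N -> ideal_pow J i f; last by apply.
elim=> [//|i IH] iln; apply: reg; first exact/IH/ltnW.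
by rewrite mulrC; apply: ideal_pow_le Jfx.
Qed.

End Comparison.

End Subspaces.

Theorem theorem2p4 (k : closedFieldType) (hchar : [pchar k] =i pred0)
  (d : nat) (le : rel 'X_{1..d}) (Hle : term_order le)
  (I : {mpoly k[d]} -> Prop) (HI : is_ideal I) (HmI : m_primary I) :
  (exists N : nat, forall n : nat, (N <= n)%N ->
     (HF I n <= HF (initial_ideal le I) n)%N) /\
  (depth_gr_pos (initial_ideal le I) ->
     forall n : nat, (HF I n <= HF (initial_ideal le I) n)%N).
Proof.
have [N cI] := m_primary_cofinite HmI; split.
  have [M hM] := polynomial_like_ge0_nondecreasing
    (codim_gap_polynomial_like Hle HI cI) (codim_gap_ge0 Hle HI cI).
  by exists M => n /hM; apply: (HF_le_gap Hle HI cI).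
by move=> dJ n; apply: (HF_le_gap Hle HI cI); apply: (codim_gap_nondecreasing Hle HI cI).
Qed.
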